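(* Let $X$ be a Banach space, $I$ be a directed set and $\{X_i:i\in I\}$ be an increasing family of one-complemented closed subspaces of $X$ whose union is dense in $X$. Then $$n_L(X)\ge\limsup_i n_L(X_i).$$
   Context: $X$ is a real or complex Banach space. A closed subspace $X_i$ of $X$ is one-complemented if there is a linear projection of norm one from $X$ onto $X_i$. Increasing means $X_i\subseteq X_j$ whenever $i\le j$; the $\limsup$ is that of a net indexed by $I$. For a Banach space $Z$, $\mathrm{Lip}_0(Z,Z)$ is the space of Lipschitz maps $T:Z\to Z$ with $T(0)=0$ and norm $\|T\|_L=\sup_{x\ne y}\|Tx-Ty\|/\|x-y\|$; $D(z)=\{z^*\in Z^*: z^*(z)=\|z^*\|\|z\|=\|z\|^2\}$; $\nu_L(T)=\sup\left\{\frac{|z^*(Tx-Ty)|}{\|x-y\|^2}: x\ne y \text{ in } Z,\ z^*\in D(x-y)\right\}$; and $n_L(Z)=\inf\{\nu_L(T): T\in\mathrm{Lip}_0(Z,Z),\ \|T\|_L=1\}$. *)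

(* Defs.v *)
From HB Require Import structures.
From mathcomp Require Import all_boot all_order all_algebra.
From mathcomp Require Import all_classical all_reals all_analysis.
From mathcomp Require Import complex.

Set Implicit Arguments.
Unset Strict Implicit.
Unset Printing Implicit Defensive.

Import Order.TTheory GRing.Theory Num.Theory.
Import numFieldNormedType.Exports.

Local Open Scope classical_set_scope.
Local Open Scope ring_scope.

Variant scalar_kind := RealScalars | ComplexScalars.

Definition scalars (R : realType) (k : scalar_kind) : numFieldType :=
  match k with RealScalars => R | ComplexScalars => R[i] end.

Definition of_real (R : realType) (k : scalar_kind) : R -> scalars R k :=
  match k return R -> scalars R k with
  | RealScalars => fun r => r
  | ComplexScalars => fun r => Complex r 0
  end.

Definition real_part (R : realType) (k : scalar_kind) : scalars R k -> R :=
  match k return scalars R k -> R with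
  | RealScalars => fun z => z
  | ComplexScalars => fun z => complex.Re z
  end.

(* The library norm of a normed module over K takes its values in K; over the
   complex scalars it is a complex number with zero imaginary part.  [nrm] is
   the same norm, read in R. *)
Definition nrm (R : realType) (k : scalar_kind)
    (Z : normedModType (scalars R k)) (z : Z) : R :=
  real_part `|z|.

Section ClosedSubspace.
Variables (K : numFieldType) (X : completeNormedModType K).

Record closed_subspace := ClosedSubspace {
  carrier :> set X ;
  carrier0 : carrier 0 ;
  carrier_linear : forall (a : K) (x y : X),
    carrier x -> carrier y -> carrier (a *: x + y) ;
  carrier_closed : closed carrier }.

Variable V : closed_subspace.

(* A fresh name for the sigma type [set_type V], which the library already
   equips with the initial topology: here the topology is the one of the norm
   inherited from X. *)
Definition subspace_type : Type := {x : X | x \in carrier V}.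

HB.instance Definition _ := [isSub of subspace_type for @proj1_sig _ _].
HB.instance Definition _ := [Choice of subspace_type by <:].

Lemma subspace_submod : subsemimod_closed (mem (carrier V)).
Proof.
split; first split.
- by apply/mem_set; exact: carrier0.
- move=> x y /set_mem Vx /set_mem Vy; apply/mem_set.
  by rewrite -[x]scale1r; exact: carrier_linear.
- move=> a x /set_mem Vx; apply/mem_set; rewrite -[a *: x]addr0.
  by apply: carrier_linear => //; exact: carrier0.
Qed.

HB.instance Definition _ :=
  GRing.SubChoice_isSubLmodule.Build K X (mem (carrier V)) subspace_type
    subspace_submod.

Definition subspace_norm (x : subspace_type) : K := `|val x|.

Lemma subspace_normD (x y : subspace_type) :
  subspace_norm (x + y) <= subspace_norm x + subspace_norm y.
Proof. exact: ler_normD. Qed.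

Lemma subspace_normZ (a : K) (x : subspace_type) :
  subspace_norm (a *: x) = `|a| * subspace_norm x.
Proof. exact: normrZ. Qed.

Lemma subspace_norm0_eq0 (x : subspace_type) : subspace_norm x = 0 -> x = 0.
Proof. by move=> /normr0_eq0 x0; apply: val_inj; rewrite x0. Qed.

HB.instance Definition _ := Lmodule_isNormed.Build K subspace_type
  subspace_normD subspace_normZ subspace_norm0_eq0.

Lemma subspace_complete (F : set_system subspace_type) :
  ProperFilter F -> cauchy F -> cvg F.
Proof.
move=> FF /cauchyP cF.
pose v : subspace_type -> X := val.
have cG : cauchy (v @ F).
  apply/cauchyP => e e0; have [x Fx] := cF e e0; exists (v x).
  rewrite /fmap/=; apply: filterS Fx => y.
  by rewrite -!ball_normE.
have /cvg_ex[l Gl] : cvg (v @ F) by exact: cauchy_cvg.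
have Vl : carrier V l.
  apply: (closed_cvg (carrier V) (@carrier_closed V) _ l Gl).
  by apply: nearW => x; apply/set_mem; exact: (valP x).
apply/cvg_ex; exists (exist _ l (mem_set Vl) : subspace_type).
apply/cvgrPdist_lt => e e0.
by move/cvgrPdist_lt: Gl => /(_ e e0).
Qed.

HB.instance Definition _ :=
  Uniform_isComplete.Build subspace_type subspace_complete.

End ClosedSubspace.

Section NumericalIndex.
Variables (R : realType) (k : scalar_kind).
Local Notation K := (scalars R k).
Local Open Scope ereal_scope.

Definition opnorm (Y Z : normedModType K) (f : Y -> Z) : \bar R :=
  ereal_sup [set (nrm (f x))%:E | x in [set x : Y | (nrm x <= 1)%R]].

Definition one_complemented (X : completeNormedModType K)
    (V : closed_subspace X) : Prop :=
  exists P : {linear X -> X},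
    [/\ forall x, P (P x) = P x, range P = V & opnorm P = 1].

Definition lipnorm (Z : normedModType K) (T : Z -> Z) : \bar R :=
  ereal_sup [set r | exists x y : Z, x != y /\
    r = (nrm (T x - T y) / nrm (x - y))%:E].

Definition Lip0 (Z : normedModType K) : set (Z -> Z) :=
  [set T | T 0%R = 0%R /\ exists c : K, c.-lipschitz T].

(* The middle term of z^*(z) = ||z^*|| ||z|| = ||z||^2 is an extended real and
   the left one an element of K, so both are compared with the right one. *)
Definition D (Z : normedModType K) (z : Z) : set {linear Z -> K^o} :=
  [set f | [/\ continuous f,
               f z = of_real k (nrm z ^+ 2) &
               opnorm (f : Z -> K^o) * (nrm z)%:E = (nrm z ^+ 2)%:E]].

Definition nu_L (Z : normedModType K) (T : Z -> Z) : \bar R :=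
  ereal_sup [set r | exists (x y : Z) (f : {linear Z -> K^o}),
    [/\ x != y, D (x - y)%R f &
        r = (nrm (f (T x - T y)%R) / nrm (x - y) ^+ 2)%:E]].

(* On the zero space no T has norm 1 and the infimum is +oo. *)
Definition n_L (Z : completeNormedModType K) : \bar R :=
  ereal_inf [set nu_L T | T in [set T : Z -> Z | Lip0 T /\ lipnorm T = 1]].

End NumericalIndex.

Record directed_set (I : Type) (le : I -> I -> Prop) : Prop := DirectedSet {
  dir_inhabited : inhabited I ;
  dir_refl : forall i, le i i ;
  dir_trans : forall i j l, le i j -> le j l -> le i l ;
  dir_upper : forall i j, exists l, le i l /\ le j l }.

Definition net_limsup (R : realType) (I : Type) (le : I -> I -> Prop)
    (a : I -> \bar R) : \bar R :=
  ereal_inf [set ereal_sup [set a j | j in [set j | le i j]] | i in setT].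

(* Main.v *)
(* For a Lipschitz map T of X with norm 1 and a norm-one projection Q_j of X
   onto X_j, put T_j = Q_j o T|X_j. If f is in D(x - y) for x, y in X_j, then
   f o Q_j is in D(x - y) in X, so nu_L(T_j) <= nu_L(T). Two points at which
   the slope of T exceeds t < 1, and the difference of their images, are
   approximated by elements of some X_i; for j >= i the map Q_j fixes these
   elements, whence ||T_j||_L >= t. Normalizing T_j gives
   n_L(X_j) <= nu_L(T) / t for all j >= i, and t is arbitrary in ]0, 1[. *)
Require Import Defs.
From HB Require Import structures.
From mathcomp Require Import all_boot all_order all_algebra.
From mathcomp Require Import all_classical all_reals all_analysis.
From mathcomp Require Import complex ring lra.

Set Implicit Arguments.
Unset Strict Implicit.

Import Order.TTheory GRing.Theory Num.Theory.
Import numFieldNormedType.Exports.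

Local Open Scope classical_set_scope.
Local Open Scope ring_scope.

(** * The norm read in the reals *)

Section RealNorm.
Variables (R : realType) (k : scalar_kind).
Local Notation K := (scalars R k).
Local Notation "r %:K" := (of_real k r) (at level 2, format "r %:K").

Lemma of_real_le (a b : R) : (a%:K <= b%:K) = (a <= b).
Proof. by case: k => //=; rewrite lecR. Qed.

Lemma of_real_lt (a b : R) : (a%:K < b%:K) = (a < b).
Proof. by case: k => //=; rewrite ltcR. Qed.

Lemma of_realK : cancel (of_real k) (@real_part R k).
Proof. by move=> a; case: k. Qed.

Lemma of_real0 : 0%:K = 0 :> K.
Proof. by case: k. Qed.

Lemma of_realD (a b : R) : (a + b)%:K = a%:K + b%:K.
Proof. by case: k => //; exact: (rmorphD (real_complex R)). Qed.

Lemma of_realM (a b : R) : (a * b)%:K = a%:K * b%:K.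
Proof. by case: k => //; exact: (rmorphM (real_complex R)). Qed.

(** The order on the complex numbers compares only numbers with equal imaginary parts, so [0 <= a]
    forces [a] to be real. *)
Lemma real_partK (a : K) : 0 <= a -> (real_part a)%:K = a.
Proof.
by case: k a => //= -[r i]; rewrite lecE/= => /andP[/eqP -> _].
Qed.

Variable Z : normedModType K.
Implicit Types x y z : Z.

Lemma of_real_nrm z : (nrm z)%:K = `|z|.
Proof. by rewrite /nrm real_partK. Qed.

Lemma nrm_ge0 z : 0 <= nrm z.
Proof. by rewrite -of_real_le of_real_nrm of_real0. Qed.

Lemma nrm_eq0 z : (nrm z == 0) = (z == 0).
Proof.
by rewrite -(can_eq of_realK) of_real_nrm of_real0 normr_eq0.
Qed.

Lemma nrm0 : nrm (0 : Z) = 0.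
Proof. by apply/eqP; rewrite nrm_eq0. Qed.

Lemma nrm_gt0 z : (0 < nrm z) = (z != 0).
Proof. by rewrite lt0r nrm_eq0 nrm_ge0 andbT. Qed.

Lemma nrmN z : nrm (- z) = nrm z.
Proof. by rewrite /nrm normrN. Qed.

Lemma nrmB x y : nrm (x - y) = nrm (y - x).
Proof. by rewrite -nrmN opprB. Qed.

Lemma nrmD x y : nrm (x + y) <= nrm x + nrm y.
Proof. by rewrite -of_real_le of_realD !of_real_nrm ler_normD. Qed.

Lemma nrmZ (a : R) z : 0 <= a -> nrm (a%:K *: z) = a * nrm z.
Proof.
move=> a0; apply: (can_inj of_realK).
rewrite of_realM !of_real_nrm normrZ ger0_norm//.
by rewrite -of_real0 of_real_le.
Qed.

Lemma dense_nrm (A : set Z) : dense A ->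
  forall z (e : R), 0 < e -> exists2 a, A a & nrm (z - a) < e.
Proof.
move=> dA z e e0.
have eK : 0 < e%:K by rewrite -of_real0 of_real_lt.
(* [dense] speaks of nonempty open sets, hence the interior of the ball. *)
have [|a [/= + Aa]] := dA _ _ (@open_interior Z (ball z e%:K)).
  by exists z; exact: nbhsx_ballx.
move=> /interior_subset; rewrite -ball_normE /= => za; exists a => //.
by rewrite -of_real_lt of_real_nrm.
Qed.

End RealNorm.

Lemma opnorm_bound (R : realType) (k : scalar_kind)
    (Y Z : normedModType (scalars R k)) (f : {linear Z -> Y}) (c : R) (z : Z) :
  opnorm f = c%:E -> nrm (f z) <= c * nrm z.
Proof.
move=> fc; have [->|z0] := eqVneq z 0.
  by rewrite linear0 !nrm0 mulr0.
have nz : 0 < nrm z by rewrite nrm_gt0.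
have nz' : 0 <= (nrm z)^-1 by rewrite invr_ge0 ltW.
have : ((nrm (f (of_real k (nrm z)^-1 *: z)))%:E <= opnorm f)%E.
  apply: ereal_sup_ubound; exists (of_real k (nrm z)^-1 *: z) => //=.
  by rewrite nrmZ// mulVf ?gt_eqF.
by rewrite fc linearZ nrmZ// lee_fin ler_pdivrMl// mulrC.
Qed.

(** * Slopes and the Lipschitz norm *)

Section LipschitzNorm.
Variables (R : realType) (k : scalar_kind).
Local Notation "r %:K" := (of_real k r) (at level 2, format "r %:K").
Variable Z : normedModType (scalars R k).

Lemma nrm_le_lipnorm (T : Z -> Z) (c : R) x y :
  (lipnorm T <= c%:E)%E -> nrm (T x - T y) <= c * nrm (x - y).
Proof.
move=> Tc; have [->|xy] := eqVneq x y; first by rewrite !subrr nrm0 mulr0.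
rewrite -ler_pdivrMr ?nrm_gt0 ?subr_eq0// -lee_fin.
by apply: le_trans Tc; apply: ereal_sup_ubound; exists x, y.
Qed.

Lemma lipnorm_normalized (T : Z -> Z) (c : R) : 0 < c ->
  lipnorm T = c%:E -> lipnorm (fun z => c^-1%:K *: T z) = 1%E.
Proof.
move=> c0 Tc; have c'0 : 0 <= c^-1 by rewrite invr_ge0 ltW.
apply/eqP; rewrite eq_le; apply/andP; split.
  apply: ge_ereal_sup => _ [x [y [xy ->]]].
  rewrite lee_fin -scalerBr nrmZ// ler_pdivrMr ?nrm_gt0 ?subr_eq0//.
  by rewrite mul1r ler_pdivrMl// nrm_le_lipnorm ?Tc.
(* For the reverse inequality multiply by [c]: each slope of [T] is [c] times a slope of the
   normalized map. *)
have c0E : (0 < c%:E)%E by rewrite lte_fin.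
rewrite -(@lee_pmul2l _ c%:E)// mule1 -{1}Tc.
apply: ge_ereal_sup => _ [x [y [xy ->]]].
rewrite -[(nrm _ / _)%R](mulVKf (lt0r_neq0 c0)) EFinM lee_pmul2l//.
apply: ereal_sup_ubound; exists x, y; split => //.
by rewrite -scalerBr nrmZ// mulrA.
Qed.

Lemma Lip0_lipnorm (T : Z -> Z) (c : R) :
  T 0 = 0 -> (lipnorm T <= c%:E)%E -> Lip0 T.
Proof.
move=> T0 Tc; split=> //; exists c%:K => -[x y] _ /=.
by rewrite -!of_real_nrm -of_realM of_real_le nrm_le_lipnorm.
Qed.

End LipschitzNorm.

(** * Compression of a map to a one-complemented subspace *)

Section Compression.
Variables (R : realType) (k : scalar_kind).
Local Notation K := (scalars R k).
Variable X : completeNormedModType K.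

(** The projection is corestricted to its range, so that maps of [X] can be turned into self-maps of
    the normed space [subspace_type V]. *)
Lemma one_complemented_retraction (V : closed_subspace X) :
  one_complemented V ->
  exists Q : {linear X -> subspace_type V},
    (forall v, Q (val v) = v) /\ forall x, nrm (Q x) <= nrm x.
Proof.
move=> [P [PP PV P1]].
have VP x : P x \in carrier V by apply/mem_set; rewrite -PV; exists x.
pose Q x : subspace_type V := exist _ (P x) (VP x).
have linQ : linear Q.
  by move=> a x y; apply: val_inj; rewrite /= linearP.
pose Ql : {linear X -> subspace_type V} :=
  HB.pack Q (GRing.isLinear.Build _ _ _ _ Q linQ).
exists Ql; split=> [v|x]; last by rewrite -[leRHS]mul1r (opnorm_bound _ P1).
apply: val_inj => /=.
have : (range P) (val v) by rewrite PV; apply/set_mem; exact: valP v.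
by case=> x _ <-; exact: PP.
Qed.

Variables (V : closed_subspace X) (Q : {linear X -> subspace_type V}).
Hypothesis QvalK : forall v, Q (val v) = v.
Hypothesis nrmQ : forall x, nrm (Q x) <= nrm x.

Lemma retraction_continuous : continuous Q.
Proof.
move=> x; apply/cvgrPdist_lt => e e0; near=> y.
rewrite -linearB; apply: (@le_lt_trans _ _ `|x - y|).
  by rewrite -!of_real_nrm of_real_le.
by near: y; apply: cvgr_dist_lt.
Unshelve. all: by end_near. Qed.

(** [Q] maps the unit ball of [X] onto that of [V]: it does not increase norms, and it fixes the
    points of [V], whose norm is inherited from [X]. *)
Lemma opnorm_comp_retraction (f : subspace_type V -> K^o) :
  opnorm (f \o Q) = opnorm f.
Proof.
rewrite /opnorm; congr ereal_sup; apply/seteqP; split=> _ [x /= x1 <-].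
  by exists (Q x) => //=; apply: le_trans (nrmQ x) x1.
by exists (val x) => //=; rewrite QvalK.
Qed.

Lemma D_comp_retraction (z : subspace_type V) (f : {linear subspace_type V -> K^o}) :
  D z f -> D (val z) (f \o Q).
Proof.
move=> [fc fz fn]; split=> /=.
- move=> x; apply: continuous_comp; [exact: retraction_continuous|exact: fc].
- by rewrite QvalK.
- by rewrite opnorm_comp_retraction.
Qed.

Definition compression (T : X -> X) : subspace_type V -> subspace_type V :=
  fun v => Q (T (val v)).

(** The quotient of the compression at [x], [y], [f] equals that of [T] at [val x], [val y],
    [f \o Q], so the supremum for [T] runs over a larger set. *)
Lemma compression_nu_L (T : X -> X) :
  (nu_L (compression T) <= nu_L T)%E.
Proof.
apply: ge_ereal_sup => _ [x [y [f [xy Df ->]]]].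
apply: ereal_sup_ubound; exists (val x), (val y), (f \o Q); split=> //.
- by rewrite -raddfB; exact: D_comp_retraction.
- by rewrite /compression -linearB.
Qed.

Lemma lipnorm_compression (T : X -> X) : (lipnorm (compression T) <= lipnorm T)%E.
Proof.
apply: ge_ereal_sup => _ [x [y [xy ->]]].
apply: (@le_trans _ _ (nrm (T (val x) - T (val y)) / nrm (val x - val y))%:E).
  rewrite lee_fin ler_wpM2r ?invr_ge0 ?nrm_ge0//.
  by rewrite /compression -linearB.
by apply: ereal_sup_ubound; exists (val x), (val y); rewrite (inj_eq val_inj).
Qed.

End Compression.

(** * Bounding the index by a map whose norm is not normalized *)

Section Index.
Variables (R : realType) (k : scalar_kind).
Local Notation K := (scalars R k).

Lemma n_L_le_nu_L (Z : completeNormedModType K) (T : Z -> Z) (c t : R) :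
  T 0 = 0 -> lipnorm T = c%:E -> 0 < t <= c ->
  (n_L Z <= t^-1%:E * nu_L T)%E.
Proof.
move=> T0 Tc /andP[t0 tc]; have c0 := lt_le_trans t0 tc.
have c'0 : 0 <= c^-1 by rewrite invr_ge0 ltW.
have Sc := lipnorm_normalized c0 Tc.
apply: (@le_trans _ _ (nu_L (fun z => of_real k c^-1 *: T z))).
  apply: ereal_inf_lbound; eexists; last reflexivity.
  by split=> //; apply: (@Lip0_lipnorm _ _ _ _ 1); rewrite ?Sc// T0 scaler0.
apply: ge_ereal_sup => _ [x [y [f [xy Df ->]]]].
have fT : nrm (f (of_real k c^-1 *: T x - of_real k c^-1 *: T y)) =
    c^-1 * nrm (f (T x - T y)).
  by rewrite -scalerBr linearZ; exact: nrmZ.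
rewrite lee_pdivlMl// fT -EFinM.
(* The remaining factor is [t / c], at most 1, and it multiplies a nonnegative quotient. *)
apply: (@le_trans _ _ (nrm (f (T x - T y)) / nrm (x - y) ^+ 2)%:E); last first.
  by apply: ereal_sup_ubound; exists x, y, f.
rewrite lee_fin !mulrA ler_wpM2r ?invr_ge0 ?exprn_ge0 ?nrm_ge0//.
by rewrite ler_piMl ?nrm_ge0// ler_pdivrMr// mul1r.
Qed.

(** This is the passage to the limit as [t] tends to 1, carried out with an explicit [t] for each
    tolerance [e]. *)
Lemma lee_forall_lt1 (L v : \bar R) :
  (forall t : R, 0 < t < 1 -> (L <= t^-1%:E * v)%E) -> (L <= v)%E.
Proof.
case: v => [v| |] Lv; last 2 first.
- by rewrite leey.
(* For [v] equal to minus infinity a single value of [t] suffices, as a positive multiple of [v] is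
   [v]. *)
- by have := Lv 2^-1; rewrite invrK gt0_muleNy ?lte_fin//; apply; lra.
apply/lee_addgt0Pr => e e0.
have v0 := normr_ge0 v; have vv := ler_norm v.
have p1 : 0 < `|v| + e by lra.
have p2 : 0 < `|v| + 2 * e by lra.
(* For this [t], the inequality [v / t <= v + e] reduces to [e * v <= e * |v| + e ^ 2]; the absolute
   value keeps [t] positive when [v] is negative. *)
have /Lv : 0 < (`|v| + e) / (`|v| + 2 * e) < 1.
  by rewrite divr_gt0//= ltr_pdivrMr//; lra.
move=> /le_trans; apply; rewrite -EFinM -EFinD lee_fin invf_div mulrAC.
by rewrite ler_pdivrMr//; nra.
Qed.

End Index.

(** * Slopes of [T] seen from far along the directed family *)

Section DirectedUnion.
Variables (R : realType) (k : scalar_kind).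
Local Notation K := (scalars R k).
Variables (X : completeNormedModType K) (I : Type) (le : I -> I -> Prop).
Variable Xs : I -> closed_subspace X.
Hypothesis hI : directed_set le.
Hypothesis hinc : forall i j : I, le i j -> Xs i `<=` Xs j.
Hypothesis hdense : dense (\bigcup_(i in [set: I]) Xs i).

(** The index [i] is fixed by three approximating vectors alone, before [j] and [Q] are given; this
    uniformity bounds a whole tail of the net. *)
Lemma lipnorm_compression_lower (T : X -> X) (t : R) :
  0 <= t < 1 -> (lipnorm T <= 1)%E -> (t%:E < lipnorm T)%E ->
  exists i, forall j, le i j -> forall Q : {linear X -> subspace_type (Xs j)},
    (forall v, Q (val v) = v) -> (forall x, nrm (Q x) <= nrm x) ->
    (t%:E <= lipnorm (compression Q T))%E.
Proof.
move=> /andP[t0 t1] T1 /ereal_sup_gt[_ [x [y [xy ->]]]].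
rewrite lte_fin ltr_pdivlMr ?nrm_gt0 ?subr_eq0//.
set a := nrm (T x - T y); set d := nrm (x - y) => tda.
(* The images lose 4 e in total, and the distance d gains 2 e, weighted by t < 1. *)
pose e := (a - t * d) / 6.
have e0 : 0 < e by rewrite /e divr_gt0// subr_gt0.
have [x' [ix _ xX] xx'] := dense_nrm hdense x e0.
have [y' [iy _ yX] yy'] := dense_nrm hdense y e0.
have [z [iz _ zX] zz'] := dense_nrm hdense (T x' - T y') e0.
have [i1 [ix1 iy1]] := dir_upper hI ix iy.
have [i [i1i izi]] := dir_upper hI i1 iz.
exists i => j ij Q QvalK nrmQ.
have Lx : x' \in carrier (Xs j).
  by apply/mem_set/(hinc ij)/(hinc i1i)/(hinc ix1).
have Ly : y' \in carrier (Xs j).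
  by apply/mem_set/(hinc ij)/(hinc i1i)/(hinc iy1).
have Lz : z \in carrier (Xs j).
  by apply/mem_set/(hinc ij)/(hinc izi).
have td0 : 0 <= t * d by rewrite mulr_ge0// nrm_ge0.
have six : 6 * e = a - t * d by rewrite /e; field.
(* [T] has Lipschitz constant 1, so moving each of [x] and [y] by less than [e] costs at most
   [e]. *)
have aT : a <= nrm (T x' - T y') + 2 * e.
  have -> : a = nrm ((T x' - T y') + ((T x - T x') + (T y' - T y))).
    by rewrite addrACA subrKC addKr.
  have := nrmD (T x' - T y') ((T x - T x') + (T y' - T y)).
  have := nrmD (T x - T x') (T y' - T y).
  have := nrm_le_lipnorm x x' T1.
  have := nrm_le_lipnorm y' y T1.
  by rewrite (nrmB y' y); lra.
have dd : nrm (x' - y') <= d + 2 * e.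
  have -> : x' - y' = (x - y) + ((x' - x) + (y - y')).
    by rewrite addrACA subrKC addKr.
  have := nrmD (x - y) ((x' - x) + (y - y')).
  have := nrmD (x' - x) (y - y').
  by rewrite (nrmB x' x) -/d; lra.
(* Passing to [z] costs [e]; [Q] preserves the norm of [z], and returning from [Q z] to the image of
   the difference costs another [e]. *)
have Qz : nrm (T x' - T y') <= nrm (Q (T x' - T y')) + 2 * e.
  have Qzz : nrm (Q z) = nrm z.
    by rewrite -[z in Q z]/(val (exist _ z Lz : subspace_type (Xs j))) QvalK.
  have := nrmQ (z - (T x' - T y')); rewrite linearB nrmB => h1.
  have := nrmD (Q (T x' - T y')) (Q z - Q (T x' - T y')).
  rewrite subrKC Qzz (nrmB (Q z)).
  have := nrmD z (T x' - T y' - z); rewrite subrKC.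
  by move: h1; rewrite (nrmB z); lra.
have xy' : x' != y'.
  (* Equality would give [a <= 2 * e], whereas [a >= 6 * e]. *)
  apply/eqP => xy'; move: aT; rewrite xy' subrr nrm0; lra.
pose u : subspace_type (Xs j) := exist _ x' Lx.
pose v : subspace_type (Xs j) := exist _ y' Ly.
have uv : u != v by rewrite -(inj_eq val_inj).
apply: (@le_trans _ _ (nrm (Q (T x' - T y')) / nrm (x' - y'))%:E).
  by rewrite lee_fin ler_pdivlMr ?nrm_gt0 ?subr_eq0//; nra.
apply: ereal_sup_ubound; exists u, v; split => //.
by rewrite linearB.
Qed.

End DirectedUnion.

Unset Implicit Arguments.
Set Strict Implicit.

Theorem proposition4p8 (R : realType) (k : scalar_kind)
    (X : completeNormedModType (scalars R k))
    (I : Type) (le : I -> I -> Prop) (Xs : I -> closed_subspace X)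
    (hI : directed_set le)
    (hinc : forall i j : I, le i j -> Xs i `<=` Xs j)
    (hcomp : forall i : I, one_complemented (Xs i))
    (hdense : dense (\bigcup_(i in [set: I]) Xs i)) :
  (net_limsup le (fun i => n_L (subspace_type (Xs i))) <= n_L X)%E.
Proof.
apply: le_ereal_inf_tmp => _ [T [[T0 _] T1] <-].
apply: lee_forall_lt1 => t /andP[t0 t1].
have t01 : 0 <= t < 1 by rewrite ltW.
have tT : (t%:E < lipnorm T)%E by rewrite T1 lte_fin.
have T1' : (lipnorm T <= 1)%E by rewrite T1.
have [i iP] := lipnorm_compression_lower hI hinc hdense t01 T1' tT.
(* The limsup is an infimum of suprema over tails, so it suffices to bound the tail from [i] on. *)
apply: (@Order.le_trans _ _
  (ereal_sup [set n_L (subspace_type (Xs j)) | j in [set j | le i j]])).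
  by apply: ereal_inf_lbound; exists i.
apply: ge_ereal_sup => _ [j /= ij <-].
have [Q [QvalK nrmQ]] := one_complemented_retraction (hcomp j).
have tS := iP j ij Q QvalK nrmQ.
have S1 := lipnorm_compression nrmQ T; rewrite T1 in S1.
set S := compression Q T in tS S1.
have S0 : S 0 = 0 by rewrite /S /compression raddf0 T0 raddf0.
(* Lying between [t] and 1, the norm is a real number and can serve as the normalizing constant. *)
have Sfin : lipnorm S \is a fin_num.
  by rewrite fin_real// (lt_le_trans _ tS) ?ltNyr// (le_lt_trans S1) ?ltry.
have Sc : lipnorm S = (fine (lipnorm S))%:E by rewrite fineK.
apply: le_trans (n_L_le_nu_L (t := t) S0 Sc _) _.
  by rewrite t0 -lee_fin -Sc tS.
by rewrite lee_pmul2l ?lte_fin ?invr_gt0//; exact: compression_nu_L.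
Qed.
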